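(* Let $\mathcal{C}$ be a prevariety of languages over a finite alphabet $A$ and let $L\subseteq A^*$ be a regular language with syntactic morphism $\alpha_L: A^*\to M_L$. The following are equivalent: (1) $L\in \mathit{SF}(\mathcal{C})$; (2) $L\in\mathit{SD}(\mathcal{C})$; (3) every $\mathcal{C}$-orbit for $\alpha_L$ is aperiodic, i.e., for every idempotent $e\in M_L$ and every element $x$ of the $\mathcal{C}$-orbit of $e$ for $\alpha_L$, we have $x^{\omega+1}=x^\omega$.
   Context: Fix a finite alphabet $A$; languages are subsets of $A^*$. A prevariety is a class of regular languages containing $\emptyset$ and $A^*$, closed under union, intersection, complement, and under the quotients $u^{-1}L=\{w\mid uw\in L\}$ and $Lu^{-1}=\{w\mid wu\in L\}$ for $u\in A^*$. $\mathit{SF}(\mathcal{C})$ is the least class containing $\mathcal{C}$ and all $\{a\}$ ($a\in A$), closed under union, complement and concatenation. A prefix code is $K\subseteq A^+$ with $K\cap KA^+=\emptyset$; it has synchronization delay $d\ge1$ if for all $u,v,w\in A^*$, $uvw\in K^+$ and $v\in K^d$ imply $uv\in K^+$; bounded synchronization delay means delay $d$ for some $d\ge1$. $KL$ is unambiguous if each word of $KL$ has a unique decomposition $uv$ with $u\in K,v\in L$. $\mathit{SD}(\mathcal{C})$ is the least class containing $\emptyset$ and all $\{a\}$ ($a\in A$), closed under intersection with languages of $\mathcal{C}$, disjoint union, unambiguous concatenation, and Kleene star of prefix codes of bounded synchronization delay. The syntactic congruence of $L$ is $u\equiv_L v$ iff $xuy\in L\Leftrightarrow xvy\in L$ for all $x,y\in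 A^*$; the syntactic monoid is $M_L=A^*/{\equiv_L}$ and $\alpha_L$ the quotient morphism. For a finite monoid $M$, $\omega$ denotes a positive integer such that $s^\omega$ is idempotent for all $s\in M$. For a class $\mathcal{C}$, a language $L_1$ is $\mathcal{C}$-separable from $L_2$ if some $K\in\mathcal{C}$ satisfies $L_1\subseteq K$ and $K\cap L_2=\emptyset$. For a morphism $\alpha:A^*\to M$ into a finite monoid, $(s,t)\in M^2$ is a $\mathcal{C}$-pair if $\alpha^{-1}(s)$ is not $\mathcal{C}$-separable from $\alpha^{-1}(t)$. For an idempotent $e\in M$, the $\mathcal{C}$-orbit of $e$ for $\alpha$ is the set $\{ese \mid s\in M,\ (e,s)\text{ is a }\mathcal{C}\text{-pair}\}$. *)

(* Defs.v *)
From HB Require Import structures.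
From mathcomp Require Import all_boot generic_quotient.
From mathcomp Require Import boolp.
Set Implicit Arguments.
Unset Strict Implicit.
Unset Printing Implicit Defensive.

Section Languages.
Variable A : finType.

Definition lang := seq A -> Prop.

Definition lempty : lang := fun _ => False.
Definition lfull : lang := fun _ => True.
Definition lletter (a : A) : lang := fun w => w = [:: a].
Definition lunion (K L : lang) : lang := fun w => K w \/ L w.
Definition linter (K L : lang) : lang := fun w => K w /\ L w.
Definition lcompl (L : lang) : lang := fun w => ~ L w.
Definition lconcat (K L : lang) : lang :=
  fun w => exists u v, w = u ++ v /\ K u /\ L v.
Definition lquot_l (u : seq A) (L : lang) : lang := fun w => L (u ++ w).
Definition lquot_r (L : lang) (u : seq A) : lang := fun w => L (w ++ u).

Definition lplus (K : lang) : lang :=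
  fun w => exists ws : seq (seq A), ws != [::] /\ (forall x, x \in ws -> K x) /\ w = flatten ws.
Definition lstar (K : lang) : lang :=
  fun w => exists ws : seq (seq A), (forall x, x \in ws -> K x) /\ w = flatten ws.
Definition lpow (K : lang) (d : nat) : lang :=
  fun w => exists ws : seq (seq A), size ws = d /\ (forall x, x \in ws -> K x) /\ w = flatten ws.

Definition regular (L : lang) : Prop :=
  exists (Q : finType) (q0 : Q) (delta : Q -> A -> Q) (F : pred Q),
    forall w, L w <-> F (foldl delta q0 w).

Definition lclass := lang -> Prop.

Definition prevariety (C : lclass) : Prop :=
  (forall L, C L -> regular L) /\
  C lempty /\ C lfull /\
  (forall K L, C K -> C L -> C (lunion K L)) /\
  (forall K L, C K -> C L -> C (linter K L)) /\
  (forall L, C L -> C (lcompl L)) /\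
  (forall u L, C L -> C (lquot_l u L)) /\
  (forall u L, C L -> C (lquot_r L u)).

Inductive SF (C : lclass) : lang -> Prop :=
| SF_base L : C L -> SF C L
| SF_letter a : SF C (lletter a)
| SF_union K L : SF C K -> SF C L -> SF C (lunion K L)
| SF_compl L : SF C L -> SF C (lcompl L)
| SF_concat K L : SF C K -> SF C L -> SF C (lconcat K L).

Definition prefix_code (K : lang) : Prop :=
  (forall w, K w -> w != [::]) /\
  (forall w, ~ (K w /\ exists u v, w = u ++ v /\ K u /\ v != [::])).

Definition sync_delay (K : lang) (d : nat) : Prop :=
  forall u v w, lplus K (u ++ v ++ w) -> lpow K d v -> lplus K (u ++ v).

Definition bounded_sync_delay (K : lang) : Prop :=
  exists d, 1 <= d /\ sync_delay K d.

Definition unambiguous (K L : lang) : Prop :=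
  forall u1 v1 u2 v2, u1 ++ v1 = u2 ++ v2 ->
    K u1 -> L v1 -> K u2 -> L v2 -> u1 = u2 /\ v1 = v2.

Definition disjoint_lang (K L : lang) : Prop := forall w, ~ (K w /\ L w).

Inductive SD (C : lclass) : lang -> Prop :=
| SD_empty : SD C lempty
| SD_letter a : SD C (lletter a)
| SD_inter L K : SD C L -> C K -> SD C (linter L K)
| SD_union K L : SD C K -> SD C L -> disjoint_lang K L -> SD C (lunion K L)
| SD_concat K L : SD C K -> SD C L -> unambiguous K L -> SD C (lconcat K L)
| SD_star K : SD C K -> prefix_code K -> bounded_sync_delay K -> SD C (lstar K).

Definition separable (C : lclass) (L1 L2 : lang) : Prop :=
  exists K, C K /\ (forall w, L1 w -> K w) /\ (forall w, K w -> ~ L2 w).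

Definition C_pair (C : lclass) (M : Type) (alpha : seq A -> M) (s t : M) : Prop :=
  ~ separable C (fun w => alpha w = s) (fun w => alpha w = t).

Definition C_orbit (C : lclass) (M : Type) (mul : M -> M -> M)
    (alpha : seq A -> M) (e : M) : M -> Prop :=
  fun x => exists s, C_pair C alpha e s /\ x = mul (mul e s) e.

Definition synt (L : lang) (u v : seq A) : Prop :=
  forall x y, L (x ++ u ++ y) <-> L (x ++ v ++ y).

Definition syntb (L : lang) : rel (seq A) := fun u v => `[< synt L u v >].

Lemma syntb_refl L : reflexive (syntb L).
Proof. by move=> u; apply/asboolP => x y. Qed.

Lemma syntb_sym L : symmetric (syntb L).
Proof.
move=> u v; apply/asboolP/asboolP => H x y; by split => /H.
Qed.

Lemma syntb_trans L : transitive (syntb L).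
Proof.
move=> v u w /asboolP H1 /asboolP H2; apply/asboolP => x y.
by split => [/H1/H2|/H2/H1].
Qed.

Definition synt_equiv (L : lang) : equiv_rel (seq A) :=
  EquivRel (syntb L) (@syntb_refl L) (@syntb_sym L) (@syntb_trans L).

Definition synmon (L : lang) := {eq_quot synt_equiv L}%qT.

Definition synmor (L : lang) : seq A -> synmon L := (\pi_(synmon L))%qT.

Definition synmul (L : lang) (s t : synmon L) : synmon L :=
  synmor L (repr s ++ repr t).

Definition synone (L : lang) : synmon L := synmor L [::].

Definition synpow (L : lang) (s : synmon L) (n : nat) : synmon L :=
  iter n (synmul s) (synone L).

Definition idempotent_syn (L : lang) (e : synmon L) : Prop := synmul e e = e.

Definition is_omega (L : lang) (n : nat) : Prop :=
  0 < n /\ forall s : synmon L, idempotent_syn (synpow s n).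

Definition orbits_aperiodic (C : lclass) (L : lang) : Prop :=
  forall omega, is_omega L omega ->
  forall e x : synmon L, idempotent_syn e ->
    C_orbit C (@synmul L) (synmor L) e x ->
    synpow x omega.+1 = synpow x omega.

End Languages.

(* Main.v *)
(** For [(3) => (2)], let words act on the right on the syntactic monoid [M], and
    let [X] be a subset of [M] stable under a prefix code [P] of bounded
    synchronization delay.  By induction on the size of [X] and the number of
    maps induced by [P] on [X], the words of [P*] inducing a given map on [X]
    form a language of [SD(C)].  If [P] acts on [X] by permutations, aperiodicity
    of the orbits makes the action of a word of [P*] depend only on its image
    under a morphism recognizing languages of [C].  Otherwise some non-injective
    map [q] is induced by a subset [Q] of [P]; with [R := P \ Q] one has the
    unambiguous factorization [P* = (R*Q)* R*], where [R] induces fewer maps on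
    [X] and [R*Q] sends [X] into the smaller set [q(X)].
    For [(1) => (3)], every [L] in [SF(C)] comes with a congruence with classes
    in [C] such that [w ~ ww] implies [w^m] and [w^(m+1)] are [L]-equivalent for
    large [m]; this survives concatenation, since a factorization of [x w^m y]
    leaves a large power of [w] on one side. *)
Require Import Defs.
From mathcomp Require Import all_boot generic_quotient boolp.
From mathcomp Require Import zify.

Set Implicit Arguments.
Unset Strict Implicit.
Unset Printing Implicit Defensive.

(** * Powers of words and congruences of finite index *)

Section Words.
Variable A : finType.
Implicit Types (K L P : lang A) (w u v : seq A).

Lemma lang_ext K L : (forall w, K w <-> L w) -> K = L.
Proof. by move=> h; apply/funext => w; apply/propext. Qed.

(** Levi's lemma; all later comparisons of two factorizations of one word go through it. *)
Lemma cat_eq_cat (T : Type) (u v p q : seq T) : u ++ v = p ++ q ->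
  (exists r, u = p ++ r /\ q = r ++ v) \/ (exists r, p = u ++ r /\ v = r ++ q).
Proof.
elim: u p => [|a u ih] [|b p] /=.
- by move=> ->; left; exists [::].
- by move=> ->; right; exists (b :: p).
- by move=> <-; left; exists (a :: u).
- case=> -> /ih[[r [-> ->]]|[r [-> ->]]]; [left|right]; by exists r.
Qed.

Definition wpow w n := iter n (cat w) [::].

Lemma wpowS w n : wpow w n.+1 = w ++ wpow w n. Proof. by []. Qed.

Lemma wpowD w m n : wpow w (m + n) = wpow w m ++ wpow w n.
Proof. by elim: m => // m ih; rewrite addSn !wpowS ih catA. Qed.

Lemma wpow1 w : wpow w 1 = w. Proof. by rewrite /= cats0. Qed.

Lemma wpowSr w n : wpow w n.+1 = wpow w n ++ w.
Proof. by rewrite -addn1 wpowD wpow1. Qed.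

Lemma size_wpow w n : size (wpow w n) = n * size w.
Proof. by elim: n => //= n ih; rewrite size_cat ih mulSn. Qed.

(** The cut falls in one copy of [w], split there as [t ++ t'], with [i] full copies before it and
    [j] after it. *)
Lemma wpow_eq_cat w m r r' : 0 < m -> wpow w m = r ++ r' ->
  exists i j t t', [/\ w = t ++ t', r = wpow w i ++ t, r' = t' ++ wpow w j
    & m = (i + j).+1].
Proof.
elim: m r => // m ih r _ /cat_eq_cat[[s [ew er']]|[s [er e]]].
  by exists 0, m, r, s.
case: m ih e => [|m] ih /=.
  by move/esym/nilP; rewrite cat_nilp => /andP[/nilP s0 /nilP ->];
    exists 0, 0, w, [::]; split; rewrite ?cats0 // er s0 cats0.
case/ih=> // i [j [t [t' [ew es er' em]]]].
exists i.+1, j, t, t'; split=> //; last by rewrite em.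
by rewrite er es wpowS catA.
Qed.

Definition congruent (T : Type) (g : seq A -> T) := forall u u' v v',
  g u = g u' -> g v = g v' -> g (u ++ v) = g (u' ++ v').

(** By pigeonhole the powers of [w] become periodic before exponent [#|N|]. The factorial is a
    multiple of every possible period, and the factor [#|N|.+1] takes the exponent past every
    preperiod, so one [n] serves all [w]. *)
Lemma congruent_wpow_idem (N : finType) (g : seq A -> N) : congruent g ->
  exists2 n, 0 < n & forall w, g (wpow w (n + n)) = g (wpow w n).
Proof.
move=> cg; exists (#|N|.+1 * #|N|`!); first by rewrite muln_gt0 fact_gt0.
move=> w; set n := _ * _.
have [i [j [lij jN e]]] : exists i j,
    [/\ i < j, j <= #|N| & g (wpow w i) = g (wpow w j)].
  have : ~~ injectiveb (fun i : 'I_(#|N|.+1) => g (wpow w i)).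
    by apply/negP => /injectiveP/leq_card; rewrite card_ord ltnn.
  case/injectivePn => i [j nij e].
  case: (ltngtP i j) => h; [exists i, j|exists j, i|]; rewrite ?h -1?ltnS //.
  by case/eqP: nij; apply/val_inj.
have [p pj] : exists p, j = p + i by exists (j - i); rewrite subnK // ltnW.
have p0 : 0 < p by rewrite pj -{1}(add0n i) ltn_add2r in lij.
have step m t : i <= m -> g (wpow w (t * p + m)) = g (wpow w m).
  move=> im; elim: t => // t <-.
  have -> : t.+1 * p + m = (t * p + (m - i)) + j.
    by rewrite pj mulSn; lia.
  have -> : t * p + m = (t * p + (m - i)) + i by rewrite -addnA subnK.
  by rewrite !(wpowD w (_ + _)); apply: cg.
have /dvdnP[t nt] : p %| n.
  by apply/dvdn_mull/dvdn_fact; rewrite p0 /= (leq_trans _ jN) // pj leq_addr.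
rewrite {1}nt step //.
apply: (leq_trans (ltnW lij)); apply: (leq_trans jN).
by apply: (leq_trans (leqnSn _)); rewrite leq_pmulr // fact_gt0.
Qed.

End Words.

(** * The syntactic congruence and morphisms whose classes lie in the prevariety *)

Section Syntactic.
Variable A : finType.
Implicit Types (L : lang A) (C : lclass A) (w u v : seq A).

Lemma synt_cat L u u' v v' :
  synt L u u' -> synt L v v' -> synt L (u ++ v) (u' ++ v').
Proof.
move=> hu hv x y; rewrite -!catA.
have h1 := hu x (v ++ y); have h2 := hv (x ++ u') y.
by rewrite -!catA in h1 h2; rewrite h1 h2.
Qed.

Lemma synmorP L u v : synmor L u = synmor L v <-> synt L u v.
Proof.
split=> [/eqmodP/asboolP //|h]; apply/eqmodP; exact/asboolP.
Qed.

Lemma synmor_cat L u v : synmor L (u ++ v) = synmul (synmor L u) (synmor L v).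
Proof.
apply/synmorP; apply: synt_cat; apply/synmorP;
  by rewrite {2}/synmor /synmor reprK.
Qed.

Lemma synmor_surj L (s : synmon L) : exists w, synmor L w = s.
Proof. by exists (repr s); rewrite /synmor reprK. Qed.

Lemma synmor_wpow L w n : synmor L (wpow w n) = synpow (synmor L w) n.
Proof. by elim: n => //= n <-; rewrite synmor_cat. Qed.

Lemma prevariety_bigU C (I : finType) (B : I -> Prop) (F : I -> lang A) :
  prevariety C -> (forall i, C (F i)) -> C (fun w => exists i, B i /\ F i w).
Proof.
move=> [_ [C0 [_ [CU _]]]] CF.
have -> : (fun w => exists i, B i /\ F i w) =
  (fun w => exists i, [/\ i \in enum I, B i & F i w]).
  apply: lang_ext => w; split=> [[i [? ?]]|[i [_ ? ?]]]; exists i => //.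
  by rewrite mem_enum.
elim: (enum I) => [|i s ih].
  by have -> : (fun w => exists i, [/\ i \in [::], B i & F i w]) = lempty (A:=A)
    by apply: lang_ext => w; split=> // -[? []].
have [Bi|nBi] := pselect (B i).
  have := CU _ _ (CF i) ih; congr C; apply: lang_ext => w; split.
    by case=> [?|[j [js ? ?]]]; [exists i|exists j]; rewrite inE ?eqxx ?js ?orbT.
  case=> j []; rewrite inE => /orP[/eqP ->|js] Bj Fj; [by left|right].
  by exists j.
move: ih; congr C; apply: lang_ext => w; split=> -[j [js Bj Fj]]; exists j.
  by rewrite inE js orbT.
by move: js; rewrite inE => /orP[/eqP ej|//]; rewrite ej in Bj.
Qed.

Lemma prevariety_bigI C (I : finType) (F : I -> lang A) :
  prevariety C -> (forall i, C (F i)) -> C (fun w => forall i, F i w).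
Proof.
move=> pC CF; have [_ [_ [_ [_ [_ [CC _]]]]]] := pC.
have := CC _ (prevariety_bigU (fun=> True) pC (fun i => CC _ (CF i))).
congr C; apply: lang_ext => w; split=> [h i|h [i [_]]]; last by apply.
by apply: contrapT => ?; apply: h; exists i.
Qed.

(** Finitely many contexts suffice: a left context matters only through the state it reaches, a
    right one only through the set of states it sends to acceptance. Recording membership for one
    context of each kind makes the classes Boolean combinations of quotients of [L], hence members
    of [C]. *)
Lemma regular_synt_finite L : regular L -> exists (N : finType) (g : seq A -> N),
  (forall u v, g u = g v <-> synt L u v) /\
  (forall C, prevariety C -> C L -> forall n, C (fun w => g w = n)).
Proof.
case=> Q [q0 [delta [F hL]]].
(* The empty word is a harmless default for unreachable states, and in [hy] for unrealized
   acceptance sets. *)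
have hx (q : Q) : exists x, forall x', foldl delta q0 x' = q ->
    foldl delta q0 x = q.
  have [[x ex]|nx] := pselect (exists x, foldl delta q0 x = q); first by exists x.
  by exists [::] => x' ex'; case: nx; exists x'.
have hy (f : {ffun Q -> bool}) : exists y, forall y',
    (forall q, F (foldl delta q y') = f q) -> forall q, F (foldl delta q y) = f q.
  have [[y ey]|ny] := pselect (exists y, forall q, F (foldl delta q y) = f q).
    by exists y.
  by exists [::] => y' ey'; case: ny; exists y'.
have [x xP] := choice hx; have [y yP] := choice hy.
pose g w := [ffun i : Q * {ffun Q -> bool} => `[< L (x i.1 ++ w ++ y i.2) >]].
exists {ffun Q * {ffun Q -> bool} -> bool}, g; split.
  move=> u v; split=> [/ffunP e x' y'|h].
    pose i := (foldl delta q0 x', [ffun p => F (foldl delta p y')]).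
    have key w : L (x' ++ w ++ y') <-> L (x i.1 ++ w ++ y i.2).
      rewrite !hL !foldl_cat (xP i.1 x') // (yP i.2 y') ?ffunE //.
      by move=> q; rewrite ffunE.
    apply: iff_trans (key u) (iff_trans _ (iff_sym (key v))).
    by apply: asbool_eq_equiv; have := e i; rewrite /g !ffunE.
  apply/ffunP => i; rewrite /g !ffunE; apply: asbool_equiv_eq; exact: h.
move=> C pC CL n.
have -> : (fun w => g w = n) = (fun w => forall i, g w i = n i).
  by apply: lang_ext => w; split=> [-> //|/ffunP].
apply: prevariety_bigI => // i.
have [_ [_ [_ [_ [_ [CC [Cl Cr]]]]]]] := pC.
have CLi : C (fun w => L (x i.1 ++ w ++ y i.2)).
  have := Cl (x i.1) _ (Cr (y i.2) _ CL); congr C; apply: lang_ext => w.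
  by rewrite /lquot_l /lquot_r catA.
case: (n i); [move: CLi|have := CC _ CLi]; congr C; apply: lang_ext => w;
  rewrite /g ffunE; first by split=> /asboolP.
by split=> [?|/negbT/asboolPn //]; apply/negbTE/asboolPn.
Qed.

(** A map with congruent kernel stands for a morphism to a finite monoid: the product on the image
    is implicit and values outside it have empty fibers. *)
Definition Cmorphism C (N : finType) (g : seq A -> N) :=
  congruent g /\ forall n, C (fun w => g w = n).

Lemma Cmorphism_pair C (N1 N2 : finType) (g1 : seq A -> N1) (g2 : seq A -> N2) :
  prevariety C -> Cmorphism C g1 -> Cmorphism C g2 ->
  Cmorphism C (fun w => (g1 w, g2 w)).
Proof.
move=> [_ [_ [_ [_ [CI _]]]]] [c1 C1] [c2 C2]; split.
  by move=> u u' v v' [? ?] [? ?]; congr pair; [apply: c1|apply: c2].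
move=> [n1 n2]; have := CI _ _ (C1 n1) (C2 n2); congr C; apply: lang_ext => w.
by split=> [[/= -> ->]|[<- <-]].
Qed.

Lemma Cmorphism_unit C : prevariety C -> Cmorphism C (fun _ : seq A => tt).
Proof.
move=> [_ [_ [CT _]]]; split=> // -[]; move: CT; congr C.
by apply: lang_ext => w; split.
Qed.

Lemma Cmorphism_of_lang C L : prevariety C -> C L ->
  exists (N : finType) (g : seq A -> N),
    Cmorphism C g /\ forall u v, g u = g v <-> synt L u v.
Proof.
move=> pC CL; have [N [g [gP Cg]]] := regular_synt_finite (pC.1 _ CL).
exists N, g; split=> //; split; last exact: Cg.
by move=> u u' v v' /gP hu /gP hv; apply/gP/synt_cat.
Qed.

Lemma synt_eq_lang L u v : synt L u v -> (L u <-> L v).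
Proof. by move=> /(_ [::] [::]); rewrite !cats0. Qed.

(** The product of the syntactic morphisms of the members saturates all of them at once. *)
Lemma Cmorphism_of_family C (I : finType) (F : I -> lang A) :
  prevariety C -> (forall i, C (F i)) -> exists (N : finType) (g : seq A -> N),
    Cmorphism C g /\ forall i u v, g u = g v -> F i u -> F i v.
Proof.
move=> pC CF.
suff [N [g [Cg h]]] : exists (N : finType) (g : seq A -> N), Cmorphism C g /\
    forall i, i \in enum I -> forall u v, g u = g v -> F i u -> F i v.
  by exists N, g; split=> // i; apply: h; rewrite mem_enum.
elim: (enum I) => [|i s [N [g [Cg h]]]].
  by exists unit, (fun=> tt); split=> //; apply: Cmorphism_unit.
have [N' [g' [Cg' h']]] := Cmorphism_of_lang pC (CF i).
exists (N' * N)%type, (fun w => (g' w, g w)); split; first exact: Cmorphism_pair.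
move=> j; rewrite inE => /orP[/eqP ->|js] u v [e1 e2]; last exact: h.
by case: (synt_eq_lang ((h' u v).1 e1)).
Qed.

End Syntactic.

(** * Unique decoding for prefix codes, and synchronization delay *)

Section Codes.
Variable A : finType.
Implicit Types (K L P Q R : lang A) (w u v : seq A) (us vs ws : seq (seq A)).

Definition words_in K us := forall x, x \in us -> K x.

Lemma words_in_cat K us vs :
  words_in K (us ++ vs) <-> words_in K us /\ words_in K vs.
Proof.
split=> [h|[h1 h2] x]; last by rewrite mem_cat => /orP[/h1|/h2].
by split=> x hx; apply: h; rewrite mem_cat hx ?orbT.
Qed.

Lemma words_in1 K u : words_in K [:: u] <-> K u.
Proof. by split=> [|h x]; [apply; rewrite inE | rewrite inE => /eqP ->]. Qed.

Lemma words_in_rcons K us u : words_in K (rcons us u) <-> words_in K us /\ K u.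
Proof. by rewrite -cats1 words_in_cat words_in1. Qed.

Lemma words_in_cons K us u : words_in K (u :: us) <-> K u /\ words_in K us.
Proof. by rewrite -cat1s words_in_cat words_in1. Qed.

Lemma words_in_sub K L us : (forall w, K w -> L w) ->
  words_in K us -> words_in L us.
Proof. by move=> h hu x /hu/h. Qed.

Lemma lstar_flatten K us : words_in K us -> lstar K (flatten us).
Proof. by move=> h; exists us. Qed.

Lemma lstar_nil K : lstar K [::]. Proof. by exists [::]. Qed.

Lemma lstar_cat K u v : lstar K u -> lstar K v -> lstar K (u ++ v).
Proof.
move=> [us [hu ->]] [vs [hv ->]]; rewrite -flatten_cat; apply: lstar_flatten.
exact/words_in_cat.
Qed.

Lemma lstar_sub K L w : (forall u, K u -> L u) -> lstar K w -> lstar L w.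
Proof. by move=> h [us [hu ->]]; apply/lstar_flatten/(words_in_sub h). Qed.

Lemma lstarS K : lstar K = lunion (fun w => w = [::]) (lconcat K (lstar K)).
Proof.
apply: lang_ext => w; split.
  case=> -[|u us] [hu ->]; [by left|right; exists u, (flatten us)].
  have [Ku hus] := (words_in_cons K us u).1 hu.
  by split=> //; split=> //; apply: lstar_flatten.
case=> [->|[u [v [-> [Ku sv]]]]]; first exact: lstar_nil.
by apply: lstar_cat => //; exists [:: u]; rewrite /= cats0; split=> //; apply/words_in1.
Qed.

Lemma lstar_lempty : lstar (@lempty A) = (fun w => w = [::]).
Proof.
apply: lang_ext => w; split=> [|->]; last exact: lstar_nil.
by rewrite lstarS => -[//|[? [? [_ [[]]]]]].
Qed.

Lemma prefix_code_unique P u v u' v' : prefix_code P -> P u -> P u' ->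
  u ++ v = u' ++ v' -> u = u'.
Proof.
move=> [_ pP] Pu Pu' /cat_eq_cat[[[|a r] [e _]]|[[|a r] [e _]]];
  rewrite ?cats0 in e => //; [case: (pP u)|case: (pP u')]; split=> //.
  by exists u', (a :: r).
by exists u, (a :: r).
Qed.

Lemma prefix_code_unambiguous P L : prefix_code P -> unambiguous P L.
Proof.
move=> pP u1 v1 u2 v2 e P1 _ P2 _.
have eu := prefix_code_unique pP P1 P2 e; split=> //.
by move/eqP: e; rewrite eu eqseq_cat // eqxx => /eqP.
Qed.

Lemma prefix_code_flatten_cat P us vs r : prefix_code P ->
  words_in P us -> words_in P vs -> flatten us ++ r = flatten vs ->
  exists ws, vs = us ++ ws /\ r = flatten ws.
Proof.
move=> pP; elim: us vs => [|u us ih] [|v vs] /=.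
- by exists [::].
- by move=> _ _ ->; exists (v :: vs).
- move=> /words_in_cons[Pu _] _ /nilP.
  by rewrite !cat_nilp => /andP[/andP[/nilP u0]]; case/eqP: (pP.1 _ Pu).
move=> /words_in_cons[Pu hu] /words_in_cons[Pv hv]; rewrite -catA => e.
have [euv e'] := prefix_code_unambiguous (L := lfull (A:=A)) pP e Pu I Pv I.
by have [ws [-> ->]] := ih _ hu hv e'; exists ws; rewrite euv.
Qed.

Lemma flatten_eq_nil P ws : prefix_code P -> words_in P ws ->
  flatten ws = [::] -> ws = [::].
Proof.
case: ws => // w ws [nP _] /words_in_cons[/nP nw _] /= /nilP.
by rewrite cat_nilp => /andP[/nilP ew]; rewrite ew in nw.
Qed.

Lemma prefix_code_flatten_inj P us vs : prefix_code P ->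
  words_in P us -> words_in P vs -> flatten us = flatten vs -> us = vs.
Proof.
move=> pP hu hv e; rewrite -[flatten us]cats0 in e.
have [ws [ev /esym e0]] := prefix_code_flatten_cat pP hu hv e.
have hw : words_in P ws by move: hv; rewrite ev => /words_in_cat[].
by rewrite ev (flatten_eq_nil pP hw e0) cats0.
Qed.

Lemma prefix_code_sub P R : (forall w, R w -> P w) ->
  prefix_code P -> prefix_code R.
Proof.
move=> sRP [n p]; split=> [w /sRP/n //|w [/sRP Pw [u [v [e [/sRP Pu nv]]]]]].
by apply: (p w); split=> //; exists u, v.
Qed.

(** The delay of [P] decomposes [u ++ v] over [P]; unique decoding makes this an initial part of the
    given decomposition over [R], so its factors lie in [R]. *)
Lemma bounded_sync_delay_sub P R : prefix_code P -> (forall w, R w -> P w) ->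
  bounded_sync_delay P -> bounded_sync_delay R.
Proof.
move=> pP sRP [d [d1 sP]]; exists d; split=> // u v w [ws [nws [hws e]]] [vs [sv [hv ev]]].
have [] := sP u v w.
- by exists ws; split=> //; split=> //; apply: words_in_sub hws.
- by exists vs; split=> //; split=> //; apply: words_in_sub hv.
move=> us [nus [hus eus]]; exists us; split=> //; split=> //.
rewrite catA eus in e.
have [ws' [ews _]] := prefix_code_flatten_cat pP hus (words_in_sub sRP hws) e.
by move: hws; rewrite ews => /words_in_cat[].
Qed.

(* With [R = A+ \ K A*], greedy left-to-right decoding shows that a word outside
   [K*] is a product of code words followed by a word of [R]; synchronization
   makes it enough to see the last [d] code words before that remainder. *)
Lemma compl_lstar_sync_delay K d : prefix_code K -> sync_delay K d ->
  let R : lang A := fun w => w <> [::] /\ ~ lconcat K (lfull (A:=A)) w in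
  lcompl (lstar K) = lunion
    (fun w => exists i : 'I_d, lconcat (lpow K i) R w)
    (lconcat (lfull (A:=A)) (lconcat (lpow K d) R)).
Proof.
move=> pK sK R.
have Rstar r : R r -> ~ lstar K r.
  rewrite lstarS => -[r0 rn] [//|[u [v [e [Ku _]]]]].
  by apply: rn; exists u, v; split.
have decode w : lstar K w \/ exists ws r, words_in K ws /\ R r /\ w = flatten ws ++ r.
  have [n] := ubnP (size w); elim: n w => // n ih w sw.
  have [->|/eqP w0] := eqVneq w [::]; first by left; apply: lstar_nil.
  have [[u [v [e [Ku _]]]]|nKw] := pselect (lconcat K (lfull (A:=A)) w); last first.
    by right; exists [::], w; split.
  have u0 := pK.1 _ Ku.
  have [|sv|[ws [r [hws [Rr ev]]]]] := ih v.
  - have : 0 < size u by rewrite lt0n size_eq0.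
    by move: sw; rewrite e size_cat; lia.
  - by left; rewrite lstarS; right; exists u, v.
  - right; exists (u :: ws), r; split; first exact/words_in_cons.
    by rewrite e ev /= catA.
apply: lang_ext => w; split.
  move=> nw; case: (decode w) => [//|[ws [r [hws [Rr ->]]]]].
  have [ld|ld] := ltnP (size ws) d.
    left; exists (Ordinal ld), (flatten ws), r; split=> //; split=> //.
    by exists ws.
  right; exists (flatten (take (size ws - d) ws)), (flatten (drop (size ws - d) ws) ++ r).
  rewrite catA -flatten_cat cat_take_drop; split=> //; split=> //.
  exists (flatten (drop (size ws - d) ws)), r; split=> //; split=> //.
  exists (drop (size ws - d) ws); split; first by rewrite size_drop subKn.
  by split=> // x /mem_drop/hws.
case=> [[i [u [r [-> [[us [_ [hus ->]]] Rr]]]]]|].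
  move=> [vs [hvs e]]; have [ws [ev er]] := prefix_code_flatten_cat pK hus hvs e.
  apply: (Rstar _ Rr); exists ws; split=> //.
  by move: hvs; rewrite ev => /words_in_cat[].
case=> u [_ [-> [_ [v [r [-> [Kv Rr]]]]]]] [vs [hvs e]].
(* Synchronization puts [u ++ v] in the plus of [K]; unique decoding then leaves [r] in the star,
   which [Rstar] excludes. *)
have [|us [_ [hus eu]]] := sK u v r _ Kv.
  exists vs; split=> //; case: vs e {hvs} => // /nilP.
  by rewrite !cat_nilp => /and3P[_ _ /nilP r0]; case: Rr.
rewrite catA eu in e.
have [ws [ev er]] := prefix_code_flatten_cat pK hus hvs e.
apply: (Rstar _ Rr); exists ws; split=> //.
by move: hvs; rewrite ev => /words_in_cat[].
Qed.

End Codes.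

(** * From SD to SF by complementing stars, and from SF to aperiodic orbits by pumping *)

Section StarFree.
Variables (A : finType) (C : lclass A).
Hypothesis pC : prevariety C.
Implicit Types (K L : lang A) (w u v : seq A).

Lemma SF_lfull : SF C (lfull (A:=A)).
Proof. by apply: SF_base; case: pC => _ [_ []]. Qed.

Lemma SF_lempty : SF C (lempty (A:=A)).
Proof. by apply: SF_base; case: pC => _ []. Qed.

Lemma SF_inter K L : SF C K -> SF C L -> SF C (linter K L).
Proof.
move=> hK hL; have := SF_compl (SF_union (SF_compl hK) (SF_compl hL)).
congr SF; apply: lang_ext => w; split=> [h|[h1 h2] [/(_ h1)|/(_ h2)] //].
by split; apply: contrapT => ?; apply: h; [left|right].
Qed.

Lemma SF_bigU (I : finType) (F : I -> lang A) :
  (forall i, SF C (F i)) -> SF C (fun w => exists i, F i w).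
Proof.
move=> hF.
have -> : (fun w => exists i, F i w) = (fun w => exists i, i \in enum I /\ F i w).
  apply: lang_ext => w; split=> [[i ?]|[i [_ ?]]]; exists i => //.
  by rewrite mem_enum.
elim: (enum I) => [|i s ih].
  have := SF_lempty; congr SF; apply: lang_ext => w.
  by split=> // -[? []].
have := SF_union (hF i) ih; congr SF; apply: lang_ext => w; split.
  by case=> [?|[j [js ?]]]; [exists i|exists j]; rewrite inE ?eqxx ?js ?orbT.
case=> j []; rewrite inE => /orP[/eqP ->|js] Fj; [by left|right].
by exists j.
Qed.

Lemma SF_nonempty : SF C (fun w => w <> [::]).
Proof.
have := SF_bigU (fun a => SF_concat (SF_letter C a) SF_lfull).
congr SF; apply: lang_ext => -[|a w]; split=> //.
  by case=> a [u [v [e [eu _]]]]; rewrite eu in e.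
by move=> _; exists a, [:: a], w.
Qed.

Lemma SF_lpow K n : SF C K -> SF C (lpow K n).
Proof.
move=> hK; elim: n => [|n ih].
  have := SF_compl SF_nonempty; congr SF; apply: lang_ext => w; split.
    by move=> /contrapT ->; exists [::].
  by case=> -[|u us] [//= _ [_ ->]]; apply.
have := SF_concat hK ih; congr SF; apply: lang_ext => w; split.
  case=> u [_ [-> [Ku [us [<- [hus ->]]]]]]; exists (u :: us); split=> //.
  by split=> //; apply/words_in_cons.
case=> -[|u us] [//= [sus] [/words_in_cons[Ku hus] ->]].
by exists u, (flatten us); split=> //; split=> //; exists us.
Qed.

Lemma SD_sub_SF L : SD C L -> SF C L.
Proof.
elim=> {L} [|a|L K _ hL CK|K L _ hK _ hL _|K L _ hK _ hL _|K _ hK pK [d [_ sK]]].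
- exact: SF_lempty.
- exact: SF_letter.
- by apply: SF_inter => //; apply: SF_base.
- exact: SF_union.
- exact: SF_concat.
suff : SF C (lcompl (lstar K)).
  move/SF_compl; congr SF; apply: lang_ext => w.
  by split=> [/contrapT|? ?].
rewrite (compl_lstar_sync_delay pK sK).
have SR : SF C (fun w => w <> [::] /\ ~ lconcat K (lfull (A:=A)) w).
  apply: (SF_inter SF_nonempty); apply/SF_compl/SF_concat => //; exact: SF_lfull.
apply: SF_union; first by apply: SF_bigU => i; apply: SF_concat => //; apply: SF_lpow.
by apply: SF_concat; [exact: SF_lfull | apply: SF_concat => //; apply: SF_lpow].
Qed.

Definition pumpable (N : finType) (g : seq A -> N) k L :=
  forall w, g (w ++ w) = g w -> forall m, k <= m -> forall x y,
    L (x ++ wpow w m ++ y) <-> L (x ++ wpow w m.+1 ++ y).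

Lemma lconcat_wpow_cases K L w m x y : 0 < m -> lconcat K L (x ++ wpow w m ++ y) ->
  [\/ exists p r, [/\ x = p ++ r, K p & L (r ++ wpow w m ++ y)],
      exists p r, [/\ y = p ++ r, K (x ++ wpow w m ++ p) & L r]
    | exists i j t t', [/\ w = t ++ t', m = (i + j).+1, K (x ++ wpow w i ++ t)
        & L (t' ++ wpow w j ++ y)]].
Proof.
move=> m0 [p [q [e [Kp Lq]]]].
case/cat_eq_cat: e => [[r [ex eq]]|[r [ep e]]].
  by constructor 1; exists p, r; rewrite -eq.
case/cat_eq_cat: e => [[s [ew eq]]|[s [er ey]]]; last first.
  by constructor 2; exists s, q; rewrite -er -ep.
have [i [j [t [t' [ewt et es em]]]]] := wpow_eq_cat m0 ew.
by constructor 3; exists i, j, t, t'; rewrite -et -ep catA -es -eq.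
Qed.

(** When the cut falls inside the power, [i] and [j] copies remain on its two sides. The bound
    [(k + k).+1] leaves enough of them to add or remove a copy on one side while staying at exponent
    at least [k]. *)
Lemma pumpable_concat (N : finType) (g : seq A -> N) k K L :
  pumpable g k K -> pumpable g k L -> pumpable g (k + k).+1 (lconcat K L).
Proof.
move=> hK hL w gw m km x y.
have join i j t t' : w = t ++ t' -> K (x ++ wpow w i ++ t) -> L (t' ++ wpow w j ++ y) ->
    lconcat K L (x ++ wpow w (i + j).+1 ++ y).
  move=> ew hKi hLj; exists (x ++ wpow w i ++ t), (t' ++ wpow w j ++ y).
  split=> //; rewrite -addnS wpowD wpowS -!catA; congr (_ ++ (_ ++ _)).
  by rewrite {1}ew -!catA.
have m0 : 0 < m by lia.
split=> h; [have := lconcat_wpow_cases m0 h|have := lconcat_wpow_cases (ltn0Sn m) h];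
  case=> [[p [r [ex Kp Lr]]]|[p [r [ey Kp Lr]]]|[i [j [t [t' [ew em Ki Lj]]]]]].
- exists p, (r ++ wpow w m.+1 ++ y); rewrite ex -catA; split=> //; split=> //.
  by apply/(hL w gw m) => //; lia.
- exists (x ++ wpow w m.+1 ++ p), r; rewrite ey; split; first by rewrite -!catA.
  split=> //.
  by apply/(hK w gw m) => //; lia.
- have [ki|ki] := leqP k i.
    by rewrite em -addSn; apply: join ew _ Lj; apply/(hK w gw i).
  by rewrite em -addnS; apply: join ew Ki _; apply/(hL w gw j) => //; lia.
- exists p, (r ++ wpow w m ++ y); rewrite ex -catA; split=> //; split=> //.
  by apply/(hL w gw m) => //; lia.
- exists (x ++ wpow w m ++ p), r; rewrite ey; split; first by rewrite -!catA.
  split=> //.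
  by apply/(hK w gw m) => //; lia.
- have [ki|ki] := ltnP k i.
    case: i ki em Ki => // i ki [em] Ki.
    by rewrite em addSn; apply: join ew _ Lj; apply/(hK w gw i).
  case: j em Lj => [|j]; first by lia.
  move=> [em] Lj; rewrite em addnS; apply: join ew Ki _.
  by apply/(hL w gw j) => //; lia.
Qed.

Lemma SF_pumpable L : SF C L -> exists (N : finType) (g : seq A -> N) k,
  Cmorphism C g /\ pumpable g k L.
Proof.
have two K1 K2 : (exists (N : finType) (g : seq A -> N) k, Cmorphism C g /\ pumpable g k K1) ->
    (exists (N : finType) (g : seq A -> N) k, Cmorphism C g /\ pumpable g k K2) ->
    exists (N : finType) (g : seq A -> N) k,
      [/\ Cmorphism C g, pumpable g k K1 & pumpable g k K2].
  move=> [N1 [g1 [k1 [C1 h1]]]] [N2 [g2 [k2 [C2 h2]]]].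
  exists (N1 * N2)%type, (fun w => (g1 w, g2 w)), (k1 + k2).
  split; first exact: Cmorphism_pair.
    by move=> w [e1 _] m km; apply: h1 => //; lia.
  by move=> w [_ e2] m km; apply: h2 => //; lia.
elim=> {L} [L CL|a|K L _ hK _ hL|L _ [N [g [k [Cg h]]]]|K L _ hK _ hL].
- have [N [g [Cg gP]]] := Cmorphism_of_lang pC CL.
  (* Here [g] has the syntactic congruence of [L] as kernel, so [w] and [w ++ w] are already
     interchangeable. *)
  exists N, g, 1; split=> // w /gP gw [//|m] _ x y.
  by have := gw x (wpow w m ++ y); rewrite -!catA => <-.
(* From exponent 2 on, a power of a nonempty word is too long to occur in a one-letter word. *)
- exists unit, (fun=> tt), 2; split; first exact: Cmorphism_unit.
  move=> w _ m km x y; case: w => [|b w].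
    by have e n : wpow [::] n = [::] :> seq A by elim: n.
  by split=> /(congr1 size) /=; rewrite !size_cat /= ?size_cat !size_wpow /=; nia.
- have [N [g [k [Cg h1 h2]]]] := two _ _ hK hL.
  exists N, g, k; split=> // w gw m km x y; rewrite /lunion.
  by rewrite (h1 w gw m km x y) (h2 w gw m km x y).
- exists N, g, k; split=> // w gw m km x y; rewrite /lcompl.
  by rewrite (h w gw m km x y).
have [N [g [k [Cg h1 h2]]]] := two _ _ hK hL.
by exists N, g, (k + k).+1; split=> //; apply: pumpable_concat.
Qed.

(** Otherwise the union of the [g]-classes meeting the preimage of [s] would separate it from that
    of [t]. *)
Lemma C_pair_Cmorphism (M : Type) (alpha : seq A -> M) (N : finType)
  (g : seq A -> N) s t : Cmorphism C g -> C_pair C alpha s t ->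
  exists u v, [/\ alpha u = s, alpha v = t & g u = g v].
Proof.
move=> [_ Cg] st; apply: contrapT => nuv; apply: st.
exists (fun w => exists n, (exists2 u, alpha u = s & g u = n) /\ g w = n).
split; first exact: prevariety_bigU.
split=> [w ws|w [n [[u us gu] gw]] wt]; first by exists (g w); split=> //; exists w.
by apply: nuv; exists u, w; rewrite gu gw.
Qed.

Lemma synpow_idem L (e : synmon L) n : idempotent_syn e -> 0 < n -> synpow e n = e.
Proof.
have [u <-] := synmor_surj e; rewrite -!synmor_wpow /idempotent_syn -!synmor_cat.
move=> eu; case: n => // n _; elim: n => [|n ih]; first by rewrite wpow1.
by rewrite wpowS synmor_cat ih -synmor_cat.
Qed.

Lemma SF_orbits_aperiodic L : SF C L -> orbits_aperiodic C L.
Proof.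
move=> /SF_pumpable[N [g [k [Cg pg]]]] om [om0 omP] e x ie [s [es ->]].
have [u [v [ue vs uv]]] := C_pair_Cmorphism Cg es.
have [n n0 idn] := congruent_wpow_idem Cg.1.
(* This [z] represents [e s e]. Replacing [v] by [u] turns it into the power of exponent [3n], so
   its [g]-class is idempotent and pumping applies to [z]. *)
pose z := wpow u (n + n.-1) ++ v ++ wpow u n.
have zx : synmor L z = synmul (synmul e s) e.
  rewrite /z catA !synmor_cat !synmor_wpow ue vs !synpow_idem //; lia.
have gz : g z = g (wpow u n).
  have -> : g z = g (wpow u ((n + n) + n)).
    rewrite /z (wpowD u (n + n)) catA; apply: Cg.1 => //.
    have -> : n + n = (n + n.-1).+1 by lia.
    by rewrite wpowSr; apply: Cg.1.
  rewrite -(idn u) [in RHS]wpowD wpowD; apply: Cg.1 => //; exact: idn.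
have gzz : g (z ++ z) = g z.
  by rewrite (Cg.1 _ _ _ _ gz gz) -wpowD idn gz.
rewrite -zx; set X := synmor L z.
have pX m : k <= m -> synpow X m.+1 = synpow X m.
  by move=> km; rewrite -!synmor_wpow; apply/synmorP => a b; symmetry; apply: pg.
(* Idempotence of the [om]-th power lets the exponent grow beyond the threshold [k]. *)
have oX : synpow X (om * k.+1) = synpow X om.
  elim: k.+1 (ltn0Sn k) => // -[|j] ih _; first by rewrite muln1.
  rewrite mulnS -synmor_wpow wpowD synmor_cat !synmor_wpow ih //; exact: omP.
have -> : synpow X om.+1 = synmul X (synpow X om) by [].
rewrite -oX; apply: (pX (om * k.+1)); nia.
Qed.

End StarFree.

(** * Splitting a prefix code [P] into [Q] and [R]: the code [R*Q] *)

Section CodeSplitting.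
Variables (A : finType) (P Q R : lang A).
Hypotheses (pP : prefix_code P) (PE : forall w, P w <-> Q w \/ R w)
  (QR : disjoint_lang Q R).

Let K := lconcat (lstar R) Q.

Let QP w : Q w -> P w. Proof. by move=> ?; apply/PE; left. Qed.
Let RP w : R w -> P w. Proof. by move=> ?; apply/PE; right. Qed.

Let K_factors k : K k -> exists l q, [/\ words_in R l, Q q & k = flatten (rcons l q)].
Proof.
case=> _ [q [-> [[l [hl ->]] Qq]]]; exists l, q; split=> //.
by rewrite -cats1 flatten_cat /= cats0.
Qed.

Let K_flatten l q : words_in R l -> Q q -> K (flatten (rcons l q)).
Proof.
move=> hl Qq; exists (flatten l), q; rewrite -cats1 flatten_cat /= cats0.
by split=> //; split=> //; apply: lstar_flatten.
Qed.

Let words_rcons l q : words_in R l -> Q q -> words_in P (rcons l q).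
Proof. by move=> hl Qq; apply/words_in_rcons; split; [apply: words_in_sub hl|apply: QP]. Qed.

Lemma star_concat_unambiguous : unambiguous (lstar R) Q.
Proof.
move=> u1 v1 u2 v2 e [l1 [h1 eu1]] Q1 [l2 [h2 eu2]] Q2; rewrite eu1 eu2 in e *.
have : rcons l1 v1 = rcons l2 v2.
  apply: (prefix_code_flatten_inj pP); [exact: words_rcons..|].
  by rewrite -!cats1 !flatten_cat /= !cats0.
by move/rcons_inj => [-> ->].
Qed.

Lemma star_concat_prefix_code : prefix_code K.
Proof.
split=> [w|w [/K_factors[l2 [q2 [h2 Q2 ew]]]
    [u [v [e [/K_factors[l1 [q1 [h1 Q1 eu]]] nv]]]]]].
  move=> /K_factors[l [q [hl Qq ->]]]; apply/eqP => /(flatten_eq_nil pP).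
  by move/(_ (words_rcons hl Qq)); case: l {hl}.
rewrite ew eu in e.
have [ws [e2 ev]] :=
  prefix_code_flatten_cat pP (words_rcons h1 Q1) (words_rcons h2 Q2) (esym e).
(* With [v] nonempty, the final [Q]-factor of the shorter word is a non-final factor of the longer
   one, hence also in [R]. *)
case/lastP: ws e2 ev => [_ ev|ws x]; first by rewrite ev in nv.
rewrite -rcons_cat => /rcons_inj[e2 _] _.
apply: (QR (w := q1)); split=> //; apply: h2.
by rewrite e2 mem_cat mem_rcons inE eqxx.
Qed.

Let star_factors w : lstar K w -> exists l, [/\ words_in P l, w = flatten l
  & l = [::] \/ exists l' q, l = rcons l' q /\ Q q].
Proof.
case=> ks [hk ->] {w}; elim/last_ind: ks hk => [_|ks k ih].
  by exists [::]; split=> //; left.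
move=> /words_in_rcons[/ih[l [hl el _]] /K_factors[l' [q [hl' Qq ->]]]].
exists (l ++ rcons l' q); split.
- by apply/words_in_cat; split=> //; apply: words_rcons.
- by rewrite -cats1 !flatten_cat el /= cats0.
- by right; exists (l ++ l'), q; rewrite rcons_cat.
Qed.

Let star_decomp l : words_in P l ->
  exists ks rs, [/\ words_in K ks, words_in R rs & flatten l = flatten ks ++ flatten rs].
Proof.
elim/last_ind: l => [_|l p ih]; first by exists [::], [::].
move=> /words_in_rcons[/ih[ks [rs [hk hr e]]] /PE[Qp|Rp]].
  exists (rcons ks (flatten rs ++ p)), [::]; split=> //.
    apply/words_in_rcons; split=> //; exists (flatten rs), p.
    by split=> //; split=> //; apply: lstar_flatten.
  by rewrite -!cats1 !flatten_cat e /= !cats0 -catA.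
exists ks, (rcons rs p); split=> //; first exact/words_in_rcons.
by rewrite -!cats1 !flatten_cat e /= !cats0 -catA.
Qed.

(** A list of words of [P] is cut after its last member in [Q]: what precedes groups into blocks of
    [R*Q], what follows lies in [R*]. *)
Lemma lstar_split : lstar P = lconcat (lstar K) (lstar R).
Proof.
apply: lang_ext => w; split.
  case=> l [/star_decomp[ks [rs [hk hr e]]] ->]; exists (flatten ks), (flatten rs).
  by split=> //; split; apply: lstar_flatten.
case=> u [v [-> [/star_factors[l [hl -> _]] hv]]].
by apply: lstar_cat; [apply: lstar_flatten|apply: lstar_sub hv].
Qed.

Lemma lstar_split_unambiguous : unambiguous (lstar K) (lstar R).
Proof.
move=> u1 v1 u2 v2 e /star_factors[l1 [h1 eu1 d1]] [r1 [hr1 ev1]]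
  /star_factors[l2 [h2 eu2 d2]] [r2 [hr2 ev2]].
have el : l1 ++ r1 = l2 ++ r2.
  apply: (prefix_code_flatten_inj pP).
  - by apply/words_in_cat; split=> //; apply: words_in_sub hr1.
  - by apply/words_in_cat; split=> //; apply: words_in_sub hr2.
  by rewrite !flatten_cat -eu1 -eu2 -ev1 -ev2.
(* If one cut comes later by [s], then [s] lies in the [R]-tail of the other factorization; but a
   nonempty [s] would end with a word of [Q]. *)
have aux l l' s r : l = l' ++ s -> words_in R (s ++ r) ->
    (l = [::] \/ exists l' q, l = rcons l' q /\ Q q) -> s = [::].
  move=> -> hs; case/lastP: s hs => // s x.
  move=> /words_in_cat[/words_in_rcons[_ Rx] _].
  rewrite -rcons_cat => -[|[l0 [q [/rcons_inj[_ <-] Qx]]]]; first by case: (_ ++ _).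
  by case: (QR (w := x)).
have l12 : l1 = l2.
  case/cat_eq_cat: el => [[s [e1 e2]]|[s [e1 e2]]]; rewrite e1.
    by rewrite e2 in hr2; rewrite (aux _ _ _ _ e1 hr2 d1) cats0.
  by rewrite e2 in hr1; rewrite (aux _ _ _ _ e1 hr1 d2) cats0.
have eu : u1 = u2 by rewrite eu1 eu2 l12.
by split=> //; move/eqP: e; rewrite eu eqseq_cat // eqxx => /eqP.
Qed.

(** The delay grows by one: the first [d] blocks contain at least [d] words of [P] and synchronize
    [P], and the extra block supplies a final word of [Q], which closes the block left open at that
    point. *)
Lemma star_concat_bounded_sync_delay :
  bounded_sync_delay P -> bounded_sync_delay K.
Proof.
case=> d [_ sP]; exists d.+1; split=> // u v w [ws [nws [hws ew]]] [vs [sv [hv ev]]].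
case/lastP: vs sv hv ev => // ks k; rewrite size_rcons => -[sk].
move=> /words_in_rcons[hk /K_factors[l [q [hl Qq ek]]]] ev.
have [ps [hps eps sps]] : exists ps, [/\ words_in P ps, flatten ks = flatten ps & d <= size ps].
  rewrite -sk; elim: ks hk {sk ev} => [|k' ks ih]; first by exists [::].
  move=> /words_in_cons[/K_factors[l' [q' [hl' Qq' ->]]] /ih[ps [hps eps sps]]].
  exists (rcons l' q' ++ ps); split.
  - by apply/words_in_cat; split=> //; apply: words_rcons.
  - by rewrite flatten_cat /= eps.
  - by rewrite size_cat size_rcons /=; lia.
have evs : v = flatten ps ++ k by rewrite ev -cats1 flatten_cat eps /= cats0.
have [us [_ [hus eus]]] : lplus P (u ++ flatten ps).
  (* Only the last [d] words of [ps] are used for synchronization, since the delay asks for exactly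
     [d]. *)
  have eps' : flatten ps =
      flatten (take (size ps - d) ps) ++ flatten (drop (size ps - d) ps).
    by rewrite -flatten_cat cat_take_drop.
  rewrite eps' catA; apply: (sP _ _ (k ++ w)).
    have : lstar K (u ++ v ++ w) by exists ws.
    move=> /star_factors[l0 [hl0 e0 _]]; exists l0; split.
      apply/eqP => l00; move: e0; rewrite l00 ew => /(flatten_eq_nil star_concat_prefix_code).
      by move=> /(_ hws) e0; rewrite e0 in nws.
    by split=> //; rewrite -e0 evs eps' -!catA.
  exists (drop (size ps - d) ps); split; first by rewrite size_drop subKn.
  by split=> // x /mem_drop/hps.
have [ks' [rs [hk' hr e]]] := star_decomp hus.
(* The trailing [R]-words [rs] merge with the factors [l] of the last block into one block ending in
   [q]. *)
exists (rcons ks' (flatten (rcons (rs ++ l) q))); split; first by case: (ks').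
split.
  by apply/words_in_rcons; split=> //; apply: K_flatten => //; apply/words_in_cat.
by rewrite evs catA eus e ek -!cats1 !flatten_cat /= !cats0 !catA.
Qed.

End CodeSplitting.

(** * Closure properties of families of fibers in SD *)

Section Fibers.
Variables (A : finType) (C : lclass A).
Implicit Types (K L : lang A) (w u v : seq A).

(** The empty word comes from the star of the empty code, whose delay condition is vacuous. *)
Lemma SD_eps : SD C (fun w => w = [::]).
Proof.
rewrite -lstar_lempty; apply: SD_star; first exact: SD_empty.
  by split=> // w [].
by exists 1; split=> // u v w _ [[|x us] [//= _ [/words_in_cons[[]]]]].
Qed.

Lemma SD_bigU (I : finType) (B : I -> Prop) (F : I -> lang A) :
  (forall i, SD C (F i)) -> (forall i j w, F i w -> F j w -> i = j) ->
  SD C (fun w => exists i, B i /\ F i w).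
Proof.
move=> hF dF.
have -> : (fun w => exists i, B i /\ F i w) =
  (fun w => exists i, [/\ i \in enum I, B i & F i w]).
  apply: lang_ext => w; split=> [[i [? ?]]|[i [_ ? ?]]]; exists i => //.
  by rewrite mem_enum.
elim: (enum I) (enum_uniq I) => [_|i s ih /= /andP[nis us]].
  by have -> : (fun w => exists i, [/\ i \in [::], B i & F i w]) = lempty (A:=A);
    [apply: lang_ext => w; split=> // -[? []]|exact: SD_empty].
have [Bi|nBi] := pselect (B i).
  have d : disjoint_lang (F i) (fun w => exists i, [/\ i \in s, B i & F i w]).
    by move=> w [Fi [j [js _ Fj]]]; rewrite (dF _ _ _ Fi Fj) js in nis.
  have := SD_union (hF i) (ih us) d; congr SD; apply: lang_ext => w; split.
    by case=> [?|[j [js ? ?]]]; [exists i|exists j]; rewrite inE ?eqxx ?js ?orbT.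
  case=> j []; rewrite inE => /orP[/eqP ->|js] Bj Fj; [by left|right].
  by exists j.
move: (ih us); congr SD; apply: lang_ext => w; split=> -[j [js Bj Fj]]; exists j.
  by rewrite inE js orbT.
by move: js; rewrite inE => /orP[/eqP ej|//]; rewrite ej in Bj.
Qed.

Definition SD_fibers (I : Type) K (g : seq A -> I) :=
  forall i, SD C (fun w => K w /\ g w = i).

Lemma SD_fibers_pred (I : finType) K (g : seq A -> I) (B : I -> Prop) :
  SD_fibers K g -> SD C (fun w => K w /\ B (g w)).
Proof.
move=> hg; have := SD_bigU B hg (fun i j w h h' => etrans (esym h.2) h'.2).
congr SD; apply: lang_ext => w.
by split=> [[i [Bi [? gw]]]|[? ?]]; [rewrite gw|exists (g w)].
Qed.

Lemma SD_fibers_map (I J : finType) K (g : seq A -> I) (h : seq A -> J) phi :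
  (forall w, K w -> h w = phi (g w)) -> SD_fibers K g -> SD_fibers K h.
Proof.
move=> hphi hg j; have := SD_fibers_pred (fun i => phi i = j) hg.
by congr SD; apply: lang_ext => w; split=> -[Kw]; rewrite hphi.
Qed.

(** Each fiber is a finite union of concatenations of fibers; unambiguity of the whole product makes
    these concatenations unambiguous and pairwise disjoint. *)
Lemma SD_fibers_concat (I J T : finType) K L (g : seq A -> I) (h : seq A -> J)
    (k : seq A -> T) phi : unambiguous K L ->
  (forall u v, K u -> L v -> k (u ++ v) = phi (g u) (h v)) ->
  SD_fibers K g -> SD_fibers L h -> SD_fibers (lconcat K L) k.
Proof.
move=> uKL hk hg hh t.
pose F (ij : I * J) := lconcat (fun w => K w /\ g w = ij.1) (fun w => L w /\ h w = ij.2).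
have hF ij : SD C (F ij).
  apply: SD_concat; [exact: hg|exact: hh|].
  by move=> u1 v1 u2 v2 e [? _] [? _] [? _] [? _]; apply: uKL.
have dF ij ij' w : F ij w -> F ij' w -> ij = ij'.
  case: ij ij' => [i j] [i' j'] [u [v [-> [[Ku gu] [Lv hv]]]]] [u' [v' [e [[Ku' gu'] [Lv' hv']]]]].
  have [eu ev] := uKL _ _ _ _ e Ku Lv Ku' Lv'.
  by rewrite /= in gu hv gu' hv'; rewrite -gu -hv -gu' -hv' eu ev.
have := SD_bigU (fun ij => phi ij.1 ij.2 = t) hF dF; congr SD; apply: lang_ext => w; split.
  case=> -[i j] [/= et [u [v [-> [[Ku gu] [Lv hv]]]]]]; split; first by exists u, v.
  by rewrite hk // gu hv.
case=> -[u [v [-> [Ku Lv]]]]; rewrite hk // => <-; exists (g u, h v); split=> //.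
by exists u, v.
Qed.

Lemma SD_fibers_union (I : Type) K L (g : seq A -> I) : disjoint_lang K L ->
  SD_fibers K g -> SD_fibers L g -> SD_fibers (lunion K L) g.
Proof.
move=> d hK hL i; have d' : disjoint_lang (fun w => K w /\ g w = i) (fun w => L w /\ g w = i).
  by move=> w [[? _] [? _]]; apply: (d w).
have := SD_union (hK i) (hL i) d'; congr SD; apply: lang_ext => w; split.
  by case=> -[]; split=> //; [left|right].
by case=> -[? ?|? ?]; [left|right].
Qed.

Lemma SD_fibers_const (I : Type) K (g : seq A -> I) i0 : SD C K ->
  (forall w, K w -> g w = i0) -> SD_fibers K g.
Proof.
move=> hK gK i; have [e|ne] := pselect (i = i0).
  move: hK; congr SD; apply: lang_ext => w; split=> [Kw|[]] //.
  by rewrite gK.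
have := SD_empty C; congr SD; apply: lang_ext => w; split=> // -[Kw gw].
by apply: ne; rewrite -gw gK.
Qed.

Lemma SD_of_fibers (I : finType) K (g : seq A -> I) : SD_fibers K g -> SD C K.
Proof.
move/(SD_fibers_pred (fun=> True)); congr SD.
by apply: lang_ext => w; split=> [[]|].
Qed.

End Fibers.

(** * The main induction: right actions restricted to stable subsets *)

Section Action.
Variables (A : finType) (C : lclass A).
Hypothesis pC : prevariety C.
Variables (M : finType) (act : M -> seq A -> M).
Hypothesis act_nil : forall m, act m [::] = m.
Hypothesis act_cat : forall m u v, act m (u ++ v) = act (act m u) v.
Implicit Types (X Y : {set M}) (K P : lang A) (w u v : seq A).

Definition stable X w := forall x, x \in X -> act x w \in X.

Definition act_inj X w := {in X &, injective (act^~ w)}.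

(** The identity off [X] gives all restrictions one finite type and makes them compose on stable
    sets. *)
Definition restr X w : {ffun M -> M} := [ffun x => if x \in X then act x w else x].

Lemma restr_cat X u v : stable X u ->
  restr X (u ++ v) = [ffun x => restr X v (restr X u x)].
Proof.
move=> su; apply/ffunP => x; rewrite !ffunE.
by case: ifP => [xX|->]; rewrite ?su ?act_cat // xX.
Qed.

Lemma stable_lstar X P w : (forall u, P u -> stable X u) -> lstar P w -> stable X w.
Proof.
move=> sP [us [hus ->]]; elim: us hus => [_ x xX|u us ih] /=; first by rewrite act_nil.
move=> /words_in_cons[Pu /ih sus] x xX; rewrite act_cat; apply: sus; exact: sP.
Qed.

Lemma act_inj_cat X u v : stable X u -> act_inj X u -> act_inj X v ->
  act_inj X (u ++ v).
Proof.
move=> su iu iv x y xX yX /=; rewrite !act_cat => /iv e.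
by apply: iu => //; apply: e; apply: su.
Qed.

Lemma act_inj_lstar X P w : (forall u, P u -> stable X u) ->
  (forall u, P u -> act_inj X u) -> lstar P w -> act_inj X w.
Proof.
move=> sP iP [us [hus ->]]; elim: us hus => [_ x y _ _|u us ih] /=; first by rewrite !act_nil.
by move=> /words_in_cons[Pu /ih]; apply: act_inj_cat; [exact: sP|exact: iP].
Qed.

Lemma stable_wpow X u n : stable X u -> stable X (wpow u n).
Proof.
move=> su; elim: n => [|n ih] x xX /=; first by rewrite act_nil.
by rewrite act_cat; apply/ih/su.
Qed.

Lemma act_inj_wpow X u n : stable X u -> act_inj X u -> act_inj X (wpow u n).
Proof.
move=> su iu; elim: n => [|n ih]; first by move=> x y _ _ /=; rewrite !act_nil.
by rewrite wpowS; apply: act_inj_cat.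
Qed.

Variables (N : finType) (g : seq A -> N).
Hypothesis Cg : Cmorphism C g.
(** The only trace of aperiodicity in this section: on words permuting [X], the action is determined
    by [g]. *)
Hypothesis gact : forall X u v, stable X u -> stable X v ->
  act_inj X u -> act_inj X v -> g u = g v -> {in X, act^~ u =1 act^~ v}.

(** Stability and injectivity pass to [P*], so by [gact] each fiber is [P*] cut by a union of
    [g]-classes, which lies in [C]. *)
Lemma SD_fibers_star_inj X P : SD C P -> prefix_code P -> bounded_sync_delay P ->
  (forall w, P w -> stable X w) -> (forall w, P w -> act_inj X w) ->
  SD_fibers C (lstar P) (restr X).
Proof.
move=> SP pP bP sP iP f.
pose B n := exists u, [/\ lstar P u, restr X u = f & g u = n].
have := SD_inter (SD_star SP pP bP) (prevariety_bigU B pC Cg.2).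
congr SD; apply: lang_ext => w; split; last first.
  by move=> [Pw fw]; split=> //; exists (g w); split=> //; exists w.
case=> Pw [n [[u [Pu <- gu]] gw]]; split=> //; apply/ffunP => x; rewrite !ffunE.
case: ifP => // xX; apply: (@gact X w u) xX; rewrite ?gw ?gu //.
- exact: stable_lstar Pw.
- exact: stable_lstar Pu.
- exact: act_inj_lstar Pw.
- exact: act_inj_lstar Pu.
Qed.

Lemma SD_fibers_star X P : prefix_code P -> bounded_sync_delay P ->
  (forall w, P w -> stable X w) -> SD_fibers C P (restr X) ->
  SD_fibers C (lstar P) (restr X).
Proof.
have [n] := ubnP #|X|; elim: n X P => // n ihn X P.
(* The inner induction, with [X] fixed, is on the number of maps induced by the code. *)
pose acts P := [set f | `[< exists2 w, P w & restr X w = f >]].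
have [m] := ubnP #|acts P|; elim: m P => // m ihm P.
rewrite !ltnS => cP cX pP bP sP fP.
have [iP|] := pselect (forall w, P w -> act_inj X w).
  exact: SD_fibers_star_inj (SD_of_fibers fP) pP bP sP iP.
case/existsNP => w0 /not_implyP[Pw0 ninj].
pose q := restr X w0.
pose Q : lang A := fun w => P w /\ restr X w = q.
pose R : lang A := fun w => P w /\ restr X w <> q.
have PE w : P w <-> Q w \/ R w.
  split=> [Pw|[[]|[]]] //; by case: (pselect (restr X w = q)); [left|right].
have QR : disjoint_lang Q R by move=> w [[_ e] [_]].
have RP w : R w -> P w by case.
have QP w : Q w -> P w by case.
have pR := prefix_code_sub RP pP.
have bR := bounded_sync_delay_sub pP RP bP.
have sR w : R w -> stable X w by move/RP/sP.
have fR : SD_fibers C R (restr X).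
  move=> f; have [e|ne] := pselect (f = q).
    have := SD_empty C; congr SD; apply: lang_ext => w; split=> // -[[_ nw] fw].
    by apply: nw; rewrite fw.
  move: (fP f); congr SD; apply: lang_ext => w; split=> [[Pw fw]|[[Pw _] fw]] //.
  by split=> //; split=> //; rewrite fw.
have fQ : SD_fibers C Q (restr X) by apply: (SD_fibers_const (i0 := q) (fP q)) => w [].
have fRs : SD_fibers C (lstar R) (restr X).
  (* The map [q] is induced by [w0] in [P] but by no word of [R], so the count drops. *)
  apply: ihm => //; apply: leq_trans cP; apply: proper_card; apply/properP; split.
    by apply/subsetP => f; rewrite !inE => /asboolP[w /RP Pw fw]; apply/asboolP; exists w.
  exists q; rewrite inE; first by apply/asboolP; exists w0.
  by apply/asboolPn => -[w [_ nw]].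
pose K := lconcat (lstar R) Q.
have sRs w : lstar R w -> stable X w by apply: stable_lstar.
pose comp (f h : {ffun M -> M}) : {ffun M -> M} := [ffun x => h (f x)].
have comp_restr u v : stable X u ->
    restr X (u ++ v) = comp (restr X u) (restr X v) by exact: restr_cat.
have fK : SD_fibers C K (restr X).
  apply: (SD_fibers_concat (phi := comp)
    (star_concat_unambiguous pP PE) _ fRs fQ) => u v Ru Qv.
  by apply: comp_restr; apply: sRs.
have pK : prefix_code K := star_concat_prefix_code pP PE QR.
have bK : bounded_sync_delay K := star_concat_bounded_sync_delay pP PE QR bP.
pose Y := q @: X.
have YX : Y \subset X.
  by apply/subsetP => _ /imsetP[x xX ->]; rewrite ffunE xX sP.
have KY w x : K w -> x \in X -> act x w \in Y.
  case=> u [v [-> [Ru [_ qv]]]] xX; rewrite act_cat; apply/imsetP.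
  by exists (act x u); [exact: sRs | rewrite -qv ffunE sRs].
have sKY w : K w -> stable Y w by move=> Kw x /(subsetP YX); apply: KY.
have cY : #|Y| < n.
  apply: leq_trans cX; rewrite ltn_neqAle leq_imset_card andbT.
  apply/negP => /imset_injP iq; apply: ninj => x y xX yX e; apply: iq => //.
  by rewrite !ffunE xX yX.
(* As [Y] is contained in [X], the action on [Y] is read off from that on [X]. *)
have fKY : SD_fibers C K (restr Y).
  pose phi (f : {ffun M -> M}) : {ffun M -> M} := [ffun y => if y \in Y then f y else y].
  apply: (SD_fibers_map (phi := phi) _ fK).
  move=> w _; apply/ffunP => y; rewrite !ffunE; case: ifP => // yY.
  by rewrite (subsetP YX).
have fKsY : SD_fibers C (lstar K) (restr Y) by apply: ihn.
have fKs : SD_fibers C (lstar K) (restr X).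
  rewrite lstarS; apply: SD_fibers_union.
  - by move=> _ [-> [u [v [/esym/nilP]]]]; rewrite cat_nilp => /andP[/nilP u0 _] [/pK.1];
      rewrite u0.
  - by apply: (SD_fibers_const (i0 := restr X [::]) (SD_eps C)) => w ->.
  (* The first word of [K] sends [X] into [Y], after which the remaining word of [K*] matters only
     through its action on [Y], known from the outer induction. *)
  pose phi (f h : {ffun M -> M}) : {ffun M -> M} :=
    [ffun x => if x \in X then h (f x) else x].
  apply: (SD_fibers_concat (phi := phi)
    (prefix_code_unambiguous (L := lstar K) pK) _ fK fKsY).
  move=> u v Ku _; apply/ffunP => x; rewrite !ffunE; case: ifP => // xX.
  by rewrite KY // act_cat.
rewrite (lstar_split PE); 
apply: (SD_fibers_concat (phi := comp) (lstar_split_unambiguous pP PE QR) _ fKs fRs).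
move=> u v Ku _; apply: comp_restr; apply: stable_lstar Ku => k Kk x xX.
by apply: (subsetP YX); apply: KY.
Qed.

(** The alphabet is a prefix code of delay 1 whose star contains every word. *)
Lemma SD_fibers_full X : (forall w, stable X w) ->
  SD_fibers C (lfull (A:=A)) (restr X).
Proof.
move=> sX; pose P : lang A := fun w => exists a, w = [:: a].
have Pw w : lstar P w.
  exists [seq [:: a] | a <- w]; rewrite flatten_map1 map_id.
  by split=> // _ /mapP[a _ ->]; exists a.
have -> : lfull (A:=A) = lstar P by apply: lang_ext.
apply: SD_fibers_star => //.
- split=> [w [a ->] //|w [[a ea] [u [v [e [[b eb] nv]]]]]].
  by rewrite ea eb in e; case: e nv => _ <-.
- exists 1; split=> // u v w _ [vs [sv [hv ev]]].
  have [ws [hws e]] := Pw (u ++ v); exists ws; split=> //.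
  case: ws e {hws} => // /nilP; rewrite cat_nilp => /andP[_ /nilP v0].
  case: vs sv hv ev => // x [] // _ /words_in1[a ->]; by rewrite v0.
move=> f.
have dl (a b : A) w : lletter a w -> lletter b w -> a = b by move=> -> [].
have := SD_bigU (fun a => restr X [:: a] = f) (SD_letter C) dl; congr SD.
apply: lang_ext => w; split=> [[a [fa ->]]|[[a ->] fa]]; last by exists a.
by split=> //; exists a.
Qed.

End Action.

(** * From aperiodic orbits to SD through right multiplication on the syntactic monoid *)

Section OrbitsToSD.
Variables (A : finType) (C : lclass A) (L : lang A).
Hypotheses (pC : prevariety C) (rL : regular L) (oL : orbits_aperiodic C L).

(** A copy of the syntactic monoid as a [finType]: restricting to reached values makes [alpha]
    surjective, with section [rep]. *)
Lemma regular_synt_surj : exists (M : finType) (alpha : seq A -> M) (rep : M -> seq A),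
  (forall u v, alpha u = alpha v <-> synt L u v) /\ cancel rep alpha.
Proof.
have [N [g [gP _]]] := regular_synt_finite rL.
pose M := {n : N | `[< exists w, g w = n >]}.
have gM w : `[< exists w', g w' = g w >] by apply/asboolP; exists w.
pose alpha w : M := exist _ (g w) (gM w).
have hr (m : M) : exists w, alpha w = m.
  by case: m => n hn; have /asboolP[w gw] := hn; exists w; apply: val_inj.
have [rep repK] := choice hr; exists M, alpha, rep; split=> // u v.
by rewrite -gP; split=> [[]|e] //; apply: val_inj.
Qed.

Lemma orbits_aperiodic_SD : SD C L.
Proof.
have [M [alpha [rep [aP repK]]]] := regular_synt_surj.
have ca : congruent alpha.
  by move=> u u' v v' /aP hu /aP hv; apply/aP/synt_cat.
have amor u v : alpha u = alpha v <-> synmor L u = synmor L v.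
  by rewrite aP synmorP.
pose act m w := alpha (rep m ++ w).
have act_nil m : act m [::] = m by rewrite /act cats0 repK.
have act_cat m u v : act m (u ++ v) = act (act m u) v.
  by rewrite /act catA; apply: ca => //; rewrite repK.
have act_alpha m u v : alpha u = alpha v -> act m u = act m v by apply: ca.
have [n n0 idn] := congruent_wpow_idem ca.
have omn : is_omega L n.
  split=> // s; have [w <-] := synmor_surj s.
  rewrite /idempotent_syn -!synmor_wpow -synmor_cat -wpowD; exact/amor.
(* A separator is chosen for every separable pair, with the empty language as default; a morphism
   [g] saturating all of them identifies only words whose images form a [C]-pair. *)
have ex_sep (st : M * M) : exists K, C K /\
    (separable C (fun w => alpha w = st.1) (fun w => alpha w = st.2) ->
      (forall w, alpha w = st.1 -> K w) /\ (forall w, K w -> alpha w <> st.2)).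
  have [[K [CK [K1 K2]]]|ns] := pselect
    (separable C (fun w => alpha w = st.1) (fun w => alpha w = st.2)); first by exists K.
  by exists (lempty (A:=A)); split=> //; case: pC => _ [].
have [sep sepP] := choice ex_sep.
have [N [g [Cg gP]]] := Cmorphism_of_family pC (fun st => (sepP st).1).
have gpair u v : g u = g v -> C_pair C (synmor L) (synmor L u) (synmor L v).
  move=> guv [K [CK [K1 K2]]].
  have [|h1 h2] := (sepP (alpha u, alpha v)).2.
    exists K; split=> //; split=> [w /amor/K1 //|w /K2 nw /amor //].
  by apply: (h2 v) => //; apply: gP guv _; apply: h1.
have gact X u v : stable act X u -> stable act X v -> act_inj act X u ->
    act_inj act X v -> g u = g v -> {in X, act^~ u =1 act^~ v}.
  move=> su sv iu iv guv.
  (* An injective idempotent map on [X] is the identity. *)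
  have fixn x : x \in X -> act x (wpow u n) = x.
    move=> xX; apply: (act_inj_wpow (n := n) act_nil act_cat su iu) => //.
      exact: stable_wpow.
    by rewrite /= -act_cat -wpowD; apply/act_alpha/idn.
  (* Since [g] agrees on [t] and the idempotent power of [u], the class of [z] lies in the orbit of
     that idempotent. Aperiodicity and injectivity make [z], hence [t], fix [X] pointwise; applying
     this to [act y u] gives the equality of the two actions. *)
  pose t := wpow u n.-1 ++ v.
  pose z := (wpow u n ++ t) ++ wpow u n.
  have gt : g (wpow u n) = g t.
    by rewrite -(prednK n0) wpowSr; apply: Cg.1.
  have st : stable act X t.
    by move=> x xX; rewrite act_cat; apply/sv/stable_wpow.
  have it : act_inj act X t.
    by apply: act_inj_cat => //; [apply: stable_wpow|apply: act_inj_wpow].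
  have actz x : x \in X -> act x z = act x t.
    by move=> xX; rewrite /z act_cat (act_cat x) !fixn //; apply: st.
  have sz : stable act X z by move=> x xX; rewrite actz //; apply: st.
  have iz : act_inj act X z by move=> x y xX yX /=; rewrite !actz //; apply: it.
  have apz : alpha (wpow z n.+1) = alpha (wpow z n).
    apply/amor; rewrite !synmor_wpow.
    apply: (oL omn (e := synmor L (wpow u n))).
      by rewrite /idempotent_syn -synmor_cat -wpowD; apply/amor.
    exists (synmor L t); split; first exact: gpair.
    by rewrite !synmor_cat.
  have fixt x : x \in X -> act x t = x.
    move=> xX; rewrite -actz //.
    apply: (act_inj_wpow (n := n) act_nil act_cat sz iz) => //; first exact: sz.
    by rewrite /= -act_cat -wpowS; apply: act_alpha.
  move=> y yX /=.
  by have := fixt _ (su _ yX); rewrite /t act_cat -(act_cat y) -wpowS prednK // fixn //.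
have full w : stable act [set: M] w by [].
have fib := SD_fibers_full pC act_nil act_cat Cg gact full.
(* The image of the class of the empty word under [w] is the class of [w], so the fibers determine
   membership in [L]. *)
have := SD_fibers_pred
  (fun f : {ffun M -> M} => exists2 w, L w & alpha w = f (alpha [::])) fib.
congr SD; apply: lang_ext => w; rewrite /restr ffunE inE.
have -> : act (alpha [::]) w = alpha w by rewrite -[in RHS](cat0s w); apply: ca.
split=> [[_ [w' Lw' e]]|Lw]; last by split=> //; exists w.
exact: (synt_eq_lang ((aP w' w).1 e)).1.
Qed.

End OrbitsToSD.

Theorem theorem5p11 (A : finType) (C : lclass A) (L : lang A) :
  prevariety C -> regular L ->
  (SF C L <-> SD C L) /\ (SD C L <-> orbits_aperiodic C L).
Proof.
move=> pC rL; have h1 := @SD_sub_SF A C pC L.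
have h2 := @SF_orbits_aperiodic A C pC L; have h3 := @orbits_aperiodic_SD A C L pC rL.
by split; split; auto.
Qed.
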